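(* Let $\alpha$ be a countable ordinal with finite big Ramsey degrees. Then $\alpha + m$ has finite big Ramsey degrees for all integers $m \ge 1$. More precisely, for all integers $n \ge 1$ and $m\ge 1$, $$T(n, \alpha + m) \le \sum_{j=0}^n \binom mj \cdot T(n - j, \alpha),$$ where $T(0, \alpha) = 1$ and $\binom mj = 0$ whenever $m < j$.
   Context: For a chain (linearly ordered set) $C$ and a finite chain $n=\{0<1<\dots<n-1\}$, let $\mathrm{Emb}(n,C)$ be the set of order embeddings $n \hookrightarrow C$. The big Ramsey degree $T(n,C)$ is the least positive integer $t$ such that for every integer $k \ge 2$ and every coloring $\chi : \mathrm{Emb}(n, C) \to k$ there is a $U \subseteq C$ order-isomorphic to $C$ with $|\chi(\mathrm{Emb}(n, U))| \le t$; if no such $t$ exists, $T(n,C)=\infty$. By convention $T(0,C)=1$. A chain $C$ has finite big Ramsey degrees if $T(n,C)<\infty$ for all integers $n\ge 1$. Ordinal addition is the usual one. *)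

(* Defs.v *)
From HB Require Import structures.
From mathcomp Require Import all_boot all_order all_algebra.
From mathcomp Require Import boolp classical_sets cardinality wochoice.
From mathcomp Require Import constructive_ereal.

Set Implicit Arguments.
Unset Strict Implicit.
Unset Printing Implicit Defensive.

Import Order.TTheory GRing.Theory Num.Theory.

Local Open Scope classical_set_scope.
Local Open Scope card_scope.

Definition ordsum (A B : Type) : Type := (A + B)%type.

Fact ordsum_display : Order.disp_t -> Order.disp_t -> Order.disp_t.
Proof. by move=> *; exact: Order.Disp tt tt. Qed.

Section OrdSum.
Context {d1 d2 : Order.disp_t} {A : orderType d1} {B : orderType d2}.
Local Open Scope order_scope.

HB.instance Definition _ := Choice.copy (ordsum A B) (A + B)%type.

Definition ordsum_le (x y : ordsum A B) : bool :=
  match x, y with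
  | inl a, inl a' => a <= a'
  | inl _, inr _ => true
  | inr _, inl _ => false
  | inr b, inr b' => b <= b'
  end.

Fact ordsum_le_anti : antisymmetric ordsum_le.
Proof. by move=> [a|b] [a'|b'] //= /le_anti ->. Qed.

Fact ordsum_le_trans : transitive ordsum_le.
Proof. by move=> [a|b] [a'|b'] [a''|b''] //=; exact: le_trans. Qed.

Fact ordsum_le_total : total ordsum_le.
Proof. by move=> [a|b] [a'|b'] //=; exact: le_total. Qed.

HB.instance Definition _ :=
  Order.isOrder.Build (ordsum_display d1 d2) (ordsum A B)
    (fun _ _ => erefl) (fun _ _ => erefl) (fun _ _ => erefl)
    ordsum_le_anti ordsum_le_trans ordsum_le_total.

End OrdSum.

(* Ordinals are represented by well-ordered chains. *)
Definition countable_ordinal d (A : orderType d) : Prop :=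
  well_order (<=%O : rel A) /\ countable [set: A].

Section BigRamsey.
Context {d : Order.disp_t}.
Implicit Types (n t : nat) (C : orderType d).

Definition Emb n C : Type :=
  {f : {ffun 'I_n -> C} |
    [forall i, forall j, (f i <= f j)%O == (i <= j)%O]}.

Definition Emb_in n C (U : set C) : set (Emb n C) :=
  [set f : Emb n C | forall i, U (sval f i)].

Definition order_isomorphic_subset C (U : set C) : Prop :=
  exists g : C -> C, {mono g : x y / (x <= y)%O} /\ range g = U.

Definition big_ramsey_bound n C t : Prop :=
  (0 < t)%N /\
  forall (k : nat) (chi : Emb n C -> 'I_k), (2 <= k)%N ->
  exists U : set C, order_isomorphic_subset U /\ chi @` Emb_in U #<= `I_t.

(* A big Ramsey degree is an integer or +oo, hence the extended integers. *)
Definition big_ramsey_degree n C : \bar int :=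
  match pselect (exists t, `[< big_ramsey_bound n C t >]) with
  | left ex => (Posz (ex_minn ex))%:E%E
  | right _ => +oo%E
  end.

Definition finite_big_ramsey_degrees C : Prop :=
  forall n, (1 <= n)%N -> (big_ramsey_degree n C < +oo)%E.

(* The convention T(0, C) = 1 is a consequence of the definition. *)
Lemma big_ramsey_degree0 C : big_ramsey_degree 0 C = 1%E.
Proof.
have b1 : big_ramsey_bound 0 C 1.
  split=> // k chi _; exists [set: C]; split.
    by exists id; split=> //; rewrite image_id.
  have [->|/set0P[f0 _]] := eqVneq (Emb_in [set: C]) (set0 : set (Emb 0 C)).
    by rewrite image_set0 card_ge0.
  rewrite -(card_le_eqr (@card_set1 _ (chi f0))); apply: subset_card_le.
  by move=> _ [f _ <-] /=; congr chi; apply/val_inj/ffunP => -[].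
rewrite /big_ramsey_degree; case: pselect => [ex|[]]; last first.
  by exists 1; apply/asboolP.
case: ex_minnP => t /asboolP[t_gt0 _] /(_ 1%N (asboolT b1)) t_le1.
by have -> : t = 1%N by apply/eqP; rewrite eqn_leq t_le1.
Qed.

End BigRamsey.

(* Main.v *)
(* An n-chain of A + m consists of an (n - j)-chain of A followed by a j-subset
   J of m.  Fixing J turns a coloring of the n-chains of A + m into a coloring
   of the (n - j)-chains of A.  Shrinking A successively for each of the
   finitely many J yields a copy A' of A on which every such coloring takes at
   most T(n - j, A) values, and the copy A' + m of A + m then sees at most
   the sum of T(n - j, A) over all J with at most n elements. *)

Require Import Defs.
From mathcomp Require Import all_boot all_order all_algebra.
From mathcomp Require Import boolp classical_sets cardinality.
From mathcomp Require Import constructive_ereal.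

Import Order.TTheory GRing.Theory Num.Theory.

Lemma card_eq_finset (T : finType) (K : {set T}) :
  ([set` K]%classic #= `I_#|K|)%card.
Proof.
have -> : [set` K]%classic =
    ((fun i : 'I_#|K| => enum_val i) @` setT)%classic.
  apply/seteqP; split=> [x /= xK|_ [i _ <-]]; last exact: enum_valP.
  by exists (enum_rank_in xK x) => //; rewrite enum_rankK_in.
apply: (card_eq_trans (inj_card_eq _)); first by move=> i j _ _ /enum_val_inj.
by rewrite card_eq_sym card_II.
Qed.

Lemma mono_lt_sorted_map d d' (C : porderType d) (D : porderType d')
    (g : C -> D) (s : seq C) :
  {mono g : x y / (x <= y)%O} -> sorted <%O (map g s) = sorted <%O s.
Proof.
move=> g_mono; rewrite sorted_map; apply: eq_sorted => x y /=.
by rewrite leW_mono.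
Qed.

Section Sequences.
Context {d : Order.disp_t}.
Implicit Type C : orderType d.

Lemma sorted_codom_Emb n C (f : Emb n C) : sorted <%O (codom (sval f)).
Proof.
case: f => f /= /forallP fP; rewrite /codom /image_mem sorted_map.
rewrite (eq_sorted (e' := relpre val ltn)).
  by rewrite -sorted_map val_enum_ord iota_ltn_sorted.
by move=> i j /=; rewrite ltNge (eqP (forallP (fP j) i)) -ltnNge.
Qed.

Lemma sorted_Emb n C (s : seq C) : sorted <%O s -> size s = n ->
  exists f : Emb n C, codom (sval f) = s.
Proof.
move=> s_sorted /eqP s_size.
pose f : {ffun 'I_n -> C} := [ffun i => tnth (Tuple s_size) i].
have fP : [forall i, forall j, (f i <= f j)%O == (i <= j)%N].
  apply/forallP => i; apply/forallP => j; apply/eqP; rewrite !ffunE.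
  have x0 := tnth (Tuple s_size) i.
  by rewrite !(tnth_nth x0) /= lt_sorted_leq_nth // inE (eqP s_size).
exists (exist _ f fP) => /=.
have -> : codom f = codom (tnth (Tuple s_size)).
  by apply: eq_codom => i; rewrite ffunE.
exact: map_tnth_enum.
Qed.

Lemma codom_Emb_inj n C (f g : Emb n C) :
  codom (sval f) = codom (sval g) -> f = g.
Proof.
move=> fg; apply/val_inj/ffunP => i /=.
by have /eq_in_map := fg; apply; rewrite mem_enum.
Qed.

(* Embeddings of n are encoded by their increasing lists of values; the values
   of psi on other lists are irrelevant. *)
Definition seq_ramsey_bound n C (t : nat) : Prop :=
  forall (k : nat) (psi : seq C -> 'I_k), (2 <= k)%N ->
  exists2 g : C -> C, {mono g : x y / (x <= y)%O} &
  exists2 K : {set 'I_k}, (#|K| <= t)%N &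
    forall s, sorted <%O s -> size s = n -> psi (map g s) \in K.

(** A copy [U] of [C] is traded for the self-embedding [g] with range [U], so that shrinking
    repeatedly becomes composing maps. The attained colors are collected in a finite set [K], so
    that counting them becomes a sum over finite sets. *)
Lemma big_ramsey_boundP n C t :
  big_ramsey_bound n C t <-> (0 < t)%N /\ seq_ramsey_bound n C t.
Proof.
split=> -[t_gt0 bnd]; split=> // k.
  move=> psi k2.
  have [_ [[g [g_mono <-]] le_t]] := bnd k (fun f => psi (codom (sval f))) k2.
  exists g => //.
  set X := (X in (X #<= _)%card) in le_t.
  exists [set c | `[< X c >]].
    rewrite -card_le_II -(card_le_eql (card_eq_finset _ _)).
    apply: card_le_trans le_t; apply: subset_card_le => c /=.
    by rewrite inE => /asboolP.
  move=> s s_sorted s_size; rewrite inE; apply/asboolP.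
  have [|| f fE] := @sorted_Emb n C (map g s).
  - by rewrite mono_lt_sorted_map.
  - by rewrite size_map.
  exists f; last by rewrite fE.
  move=> i /=; have : sval f i \in codom (sval f) by apply: codom_f.
  by rewrite fE => /mapP[x _ ->]; exists x.
move=> chi k2.
(* Lists that come from no embedding get the color 0, available since [k] is at least 2. *)
pose psi s := match pselect (exists f : Emb n C, codom (sval f) = s) with
  | left ex => chi (sval (cid ex))
  | right _ => Ordinal (ltnW k2) end.
have psiE (f : Emb n C) : psi (codom (sval f)) = chi f.
  rewrite /psi; case: pselect => [ex|[]]; last by exists f.
  by congr chi; apply: codom_Emb_inj; case: cid.
have [g g_mono [K leK gK]] := bnd k psi k2.
exists (range g); split; first by exists g.
apply: card_le_trans (_ : [set` K]%classic #<= _)%card; last first.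
  by rewrite (card_le_eql (card_eq_finset _ _)) card_le_II.
apply: subset_card_le => _ [f fg <-] /=.
(* The embedding [f] into the copy is pulled back along [g]. Only the values of [h] are chosen; they
   increase because [g] reflects the order. *)
have [h hP] : {h : 'I_n -> C & forall i, g (h i) = sval f i}.
  apply: (choice (P := fun i x => g x = sval f i)) => i.
  by have [x _ <-] := fg i; exists x.
have fE : codom (sval f) = map g (codom h).
  by rewrite /codom /image_mem -map_comp; apply: eq_map => i /=; rewrite hP.
rewrite -psiE fE; apply: gK; last by rewrite size_codom card_ord.
by rewrite -(mono_lt_sorted_map _ _ _ _ _ _ g_mono) -fE sorted_codom_Emb.
Qed.

(* Passing to a smaller copy preserves every bound already obtained, so
   finitely many colorings can be treated one after the other. *)
Lemma seq_ramsey_bound_simultaneous C (I : eqType) (r : seq I) (n_ t_ : I -> nat)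
    k (psi : I -> seq C -> 'I_k) :
  (2 <= k)%N -> (forall i, seq_ramsey_bound (n_ i) C (t_ i)) ->
  exists2 g : C -> C, {mono g : x y / (x <= y)%O} &
  exists2 K : I -> {set 'I_k}, (forall i, #|K i| <= t_ i)%N &
    forall i s, i \in r -> sorted <%O s -> size s = n_ i ->
    psi i (map g s) \in K i.
Proof.
move=> k2 bnd; elim: r => [|i0 r [g g_mono [K leK gK]]].
  by exists id => //; exists (fun=> finset.set0) => // i; rewrite cards0.
(* The coloring for [i0] is first pulled back along [g], so the next copy is found inside the
   current one. *)
have [h h_mono [L leL hL]] := bnd i0 k (fun s => psi i0 (map g s)) k2.
exists (g \o h); first by move=> x y /=; rewrite g_mono h_mono.
exists (fun i => if i == i0 then L else K i).
  by move=> i; case: eqP => // ->.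
move=> i s; rewrite inE map_comp; case: eqP => [-> _|_ /=]; first exact: hL.
by move=> ir s_sorted s_size; apply: gK; rewrite ?mono_lt_sorted_map ?size_map.
Qed.

End Sequences.

Section OrdinalSum.
Context {d : Order.disp_t} {A : orderType d} {m : nat}.

Lemma sorted_ordsum (s : seq (ordsum A 'I_m)) : sorted <%O s ->
  exists a (b : seq 'I_m), [/\ s = map inl a ++ map inr b,
    sorted <%O a & sorted <%O b].
Proof.
have inl_lt (x y : A) : ((inl x : ordsum A 'I_m) < inl y)%O = (x < y)%O.
  by rewrite !ltNge.
have inr_lt (x y : 'I_m) : ((inr x : ordsum A 'I_m) < inr y)%O = (x < y)%O.
  by rewrite !ltNge.
elim: s => [|x s IHs] xs_sorted; first by exists [::], [::].
have [a [b [sE a_sorted b_sorted]]] := IHs (path_sorted xs_sorted).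
move: xs_sorted; rewrite {}sE; case: x => [x|y].
  case: a a_sorted => [|x' a] a_sorted; first by exists [:: x], b.
  rewrite /= inl_lt => /andP[xx' _]; exists [:: x, x' & a], b.
  by split=> //=; rewrite xx'.
(* An element of ['I_m] cannot precede one of [A], so here [a] is empty. *)
case: a a_sorted => [|x' a] a_sorted; last by move=> /andP[].
case: b b_sorted => [|y' b] b_sorted; first by exists [::], [:: y].
rewrite /= inr_lt => /andP[yy' _]; exists [::], [:: y, y' & b].
by split=> //=; rewrite yy'.
Qed.

(** Increasing lists with the same elements coincide. Hence the upper parts of chains are indexed by
    the finite type of subsets of ['I_m]. *)
Lemma sorted_ord_enum (b : seq 'I_m) : sorted <%O b -> b = enum [set x in b].
Proof.
move=> b_sorted; apply: lt_sorted_eq => // [|x]; last by rewrite mem_enum inE.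
rewrite /enum_mem; apply: lt_sorted_filter; rewrite -enumT.
rewrite (eq_sorted (e' := relpre val ltn)) // -sorted_map val_enum_ord.
exact: iota_ltn_sorted.
Qed.

Lemma seq_ramsey_bound_ordsum n (t : nat -> nat) :
  (forall p, seq_ramsey_bound p A (t p)) ->
  seq_ramsey_bound n (ordsum A 'I_m)
    (\sum_(0 <= j < n.+1) 'C(m, j) * t (n - j)%N).
Proof.
move=> bnd k psi k2.
(* For [J] with more than [n] elements the truncated difference is 0; these [J] are harmless here
   and are left out of the union below. *)
have [g g_mono [K leK gK]] := @seq_ramsey_bound_simultaneous _ A _
  (enum {set 'I_m}) (fun J => n - #|J|)%N (fun J => t (n - #|J|)%N) k
  (fun J a => psi (map inl a ++ map inr (enum J))) k2 (fun J => bnd _).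
exists (fun x : ordsum A 'I_m =>
    match x with inl a => inl (g a) | inr b => inr b end).
  by move=> [a|b] [a'|b'] //; exact: g_mono.
exists (\bigcup_(J : {set 'I_m} | #|J| < n.+1) K J)%SET.
  apply: (@leq_trans (\sum_(J : {set 'I_m} | #|J| < n.+1) t (n - #|J|)%N)).
    elim/big_rec2: _ => [|J x y _ IH]; first by rewrite cards0.
    by rewrite (leq_trans (leq_card_setU _ _)) // leq_add.
  (* The subsets are grouped by cardinality [j], and ['C(m, j)] counts those of size [j]. [inord] is
     faithful on the range of summation, where [#|J|] is at most [n]. *)
  rewrite (partition_big (fun J : {set 'I_m} => inord #|J| : 'I_n.+1) xpredT) //=.
  rewrite big_mkord; apply: leq_sum => j _.
  rewrite -[m in 'C(m, _)]card_ord -card_draws -sum_nat_const.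
  rewrite [leqRHS](eq_bigl (fun J : {set 'I_m} => #|J| == j)); last first.
    by move=> J; rewrite inE.
  rewrite (eq_bigl (fun J : {set 'I_m} => #|J| == j)).
    by apply: leq_sum => J /eqP ->.
  move=> J; case: ltnP => [Jn|nJ] /=.
    by rewrite -val_eqE /= inordK.
  by apply/esym/negbTE; rewrite neq_ltn (leq_trans (ltn_ord j) nJ) orbT.
move=> s /sorted_ordsum[a [b [-> a_sorted /sorted_ord_enum bE]]].
rewrite size_cat !size_map [in size b]bE -cardE; set J := [set x in b] in bE *.
move=> sz; apply/bigcupP; exists J; first by rewrite -sz ltnS leq_addl.
rewrite map_cat -!map_comp bE.
have := gK J a; rewrite mem_enum -sz addnK -map_comp; exact.
Qed.

End OrdinalSum.

Lemma big_ramsey_degree_fin {d} {C : orderType d} n :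
  (big_ramsey_degree n C < +oo)%E ->
  exists2 t, big_ramsey_bound n C t &
    big_ramsey_degree n C = (Posz t)%:E%E.
Proof.
rewrite /big_ramsey_degree; case: pselect => [ex _|//].
by case: ex_minnP => t /asboolP bnd _; exists t.
Qed.

Lemma big_ramsey_degree_le {d} {C : orderType d} n t :
  big_ramsey_bound n C t -> (big_ramsey_degree n C <= (Posz t)%:E)%E.
Proof.
move=> bnd; rewrite /big_ramsey_degree; case: pselect => [ex|[]]; last first.
  by exists t; apply/asboolP.
by case: ex_minnP => t' _ /(_ t (asboolT bnd)); rewrite lee_fin lez_nat.
Qed.

Theorem theorem3p2 (d : Order.disp_t) (A : orderType d)
  (hA : countable_ordinal A) (hT : finite_big_ramsey_degrees A) :
  (forall m : nat, (1 <= m)%N -> finite_big_ramsey_degrees (ordsum A 'I_m)) /\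
  (forall n m : nat, (1 <= n)%N -> (1 <= m)%N ->
    (big_ramsey_degree n (ordsum A 'I_m)
     <= \sum_(0 <= j < n.+1)
          (Posz 'C(m, j))%:E * big_ramsey_degree (n - j)%N A)%E).
Proof.
have [t tP] : {t : nat -> nat & forall p,
    big_ramsey_bound p A (t p) /\ big_ramsey_degree p A = (Posz (t p))%:E%E}.
  apply: (choice (P := fun p u => big_ramsey_bound p A u /\
    big_ramsey_degree p A = (Posz u)%:E%E)) => p.
  have [|t] := @big_ramsey_degree_fin _ A p; last by exists t.
  (* [hT] covers positive [p] only; at 0 the degree is 1. *)
  by case: p => [|p]; [rewrite big_ramsey_degree0 ltry | exact: hT].
have bnd n m : (big_ramsey_degree n (ordsum A 'I_m) <=
    (Posz (\sum_(0 <= j < n.+1) 'C(m, j) * t (n - j)%N)%N)%:E)%E.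
  apply: big_ramsey_degree_le; apply/big_ramsey_boundP; split; last first.
    by apply: seq_ramsey_bound_ordsum => p; have [/big_ramsey_boundP[]] := tP p.
  (* The sum is positive because its term at [j = 0] is [t n]. *)
  by rewrite big_nat_recl // bin0 mul1n subn0 addn_gt0 (tP n).1.1.
split=> [m _ n _|n m _ _]; first exact: le_lt_trans (bnd n m) (ltry _).
apply: le_trans (bnd n m) _.
(* The two sides are equal: only the cast from naturals to extended integers has to be moved inside
   the sum. *)
rewrite -natz natr_sum -sumEFin le_eqVlt; apply/orP; left; apply/eqP.
by apply: eq_bigr => j _; rewrite (tP _).2 -EFinM -PoszM natz.
Qed.
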